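(* Let $\tau\in S_k$ satisfy at least one of: (i) $\tau_1<\tau_2$, or (ii) $k$ occurs to the right of $k-1$ in $\tau$. Then $$\liminf_{n\to\infty}\mathbb{E}^\tau_n(\mathrm{LR}_n)\leq L(\tau).$$ If moreover $k\leq 5$, or $\tau_1=1$, or $\tau_k=k$, then $\limsup_{n\to\infty}\mathbb{E}^\tau_n(\mathrm{LR}_n)\leq L(\tau)$.
   Context: $S_n(\tau)$ is the set of permutations of $[n]$ avoiding $\tau$; $L(\tau)=\lim_{n\to\infty}|S_n(\tau)|^{1/n}$. $\mathrm{LR}_n(\sigma)$ is the number of left-to-right maxima of $\sigma$ (entries $\sigma_i$ with $\sigma_i>\sigma_j$ for all $j<i$), and $\mathbb{E}^\tau_n$ is expectation under the uniform measure on $S_n(\tau)$. *)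

(* Defs.v *)
From HB Require Import structures.
From mathcomp Require Import all_boot all_order all_fingroup all_algebra.
From mathcomp Require Import all_classical all_reals all_analysis.

Set Implicit Arguments.
Unset Strict Implicit.
Unset Printing Implicit Defensive.

Import Order.TTheory GRing.Theory Num.Theory.

(* A permutation s of [n] is an element of 'S_n = {perm 'I_n}; positions and
   values are numbered from 0, so that the entry s_(i+1) is (s i).+1. *)

Definition contains (n k : nat) (s : 'S_n) (t : 'S_k) : bool :=
  [exists f : {ffun 'I_k -> 'I_n},
    [forall i : 'I_k, forall j : 'I_k,
      ((i < j) ==> (f i < f j)) && ((s (f i) < s (f j)) == (t i < t j))]].

Definition avoiders (n k : nat) (t : 'S_k) : {set 'S_n} :=
  [set s : 'S_n | ~~ contains s t].

Definition LR (n : nat) (s : 'S_n) : nat :=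
  #|[set i : 'I_n | [forall j : 'I_n, (j < i) ==> (s j < s i)]]|.

Definition expect_avoiders (R : realType) (n k : nat) (t : 'S_k)
    (X : 'S_n -> R) : R :=
  ((\sum_(s in avoiders n t) X s) / #|avoiders n t|%:R)%R.

(* The limit is taken in the extended reals, where it always exists by
   supermultiplicativity; it is finite by the Marcus-Tardos theorem. *)
Definition growth_rate (R : realType) (k : nat) (t : 'S_k) : \bar R :=
  limn (fun n : nat => ((#|avoiders n t|%:R `^ (n%:R^-1))%R : R)%:E).

(* t_1 < t_2 (so k >= 2) *)
Definition starts_with_ascent (k : nat) (t : 'S_k) : Prop :=
  exists i j : 'I_k, [/\ val i = 0, val j = 1 & t i < t j].

(* the value k occurs to the right of the value k-1 (so k >= 2) *)
Definition max_right_of_submax (k : nat) (t : 'S_k) : Prop :=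
  exists i j : 'I_k, [/\ (t i).+2 = k, (t j).+1 = k & i < j].

(* t_1 = 1 *)
Definition starts_with_min (k : nat) (t : 'S_k) : Prop :=
  exists i : 'I_k, val i = 0 /\ val (t i) = 0.

(* t_k = k *)
Definition ends_with_max (k : nat) (t : 'S_k) : Prop :=
  exists i : 'I_k, i.+1 = k /\ (t i).+1 = k.

(* Main.v *)
Require Import Defs.
From HB Require Import structures.
From mathcomp Require Import all_boot all_order all_fingroup all_algebra.
From mathcomp Require Import all_classical all_reals all_analysis.
From mathcomp Require Import zify ring lra.

Set Implicit Arguments.
Unset Strict Implicit.
Unset Printing Implicit Defensive.

(** Write a_n for the number of [t]-avoiders of size n. If [t] starts with an
    ascent, one may prepend to an avoider a value just above any left-to-right
    maximum; if k lies to the right of k-1, one may insert a new maximum just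
    before any left-to-right maximum. Hence E(LR_n) <= a_(n+1) / a_n. Direct or
    skew sums make a_n supermultiplicative, so by Fekete a_n^(1/n) tends to its
    supremum L, and the liminf of a_(n+1) / a_n is at most L.

    For the limsup, suppose that every avoider of size n accepts, for each of
    the n+1 possible values v, a new point of value v at a canonical position,
    and let A(s) be the number of points of [s] arising in this way. Then
    (n+1) a_n is the sum of A over the avoiders of size n+1. Since a removable
    point stays removable after the removal of another one, the sum of A (A-1)
    over the avoiders of size n+2 is at most (n+1) (n+2) a_n, and
    Cauchy-Schwarz gives
      (n+2) a_(n+1)^2 <= a_(n+2) ((n+1) a_n + a_(n+1)).
    Thus x_n = n a_(n-1) / a_n satisfies x_(n+1) <= x_n + 1: a ratio a_n / a_(n-1)
    exceeding L by a fixed amount stays too large on a window of length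
    proportional to n, which contradicts a_n^(1/n) -> L and a_m <= L^m.

    Canonical positions exist in two cases. If [t] is a direct sum of a prefix
    and a rest, put the new point just before the first position completing an
    occurrence of the prefix below v: the new point can then be replaced by that
    occurrence. If [t] is skew-indecomposable and has no adjacent letters
    j+1, j, put it just before the letter v-1. Up to reversal, every [t] with
    t_1 = 1, t_k = k or k <= 5 falls under one of these cases. *)

(** * Insertion and deletion of a point *)

Definition occurrence (n k : nat) (s : 'S_n) (t : 'S_k) (f : 'I_k -> 'I_n) :=
  (forall i j : 'I_k, i < j -> f i < f j) /\
  (forall i j : 'I_k, (s (f i) < s (f j)) = (t i < t j)).

Lemma containsP (n k : nat) (s : 'S_n) (t : 'S_k) :
  reflect (exists f, occurrence s t f) (contains s t).
Proof.
apply: (iffP existsP) => [[f /forallP fP]|[f [fpos fval]]].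
  exists f; split=> i j; have /forallP/(_ j)/andP[/implyP H1 /eqP H2] := fP i => //.
exists (finfun f); apply/forallP=> i; apply/forallP=> j.
rewrite !ffunE fval eqxx andbT; exact/implyP/fpos.
Qed.

Lemma mem_avoiders (n k : nat) (t : 'S_k) (s : 'S_n) :
  (s \in avoiders n t) = ~~ contains s t.
Proof. by rewrite inE. Qed.

Lemma liftE (n : nat) (i : 'I_n.+1) (x : 'I_n) : lift i x = (i <= x) + x :> nat.
Proof. by []. Qed.

(** The default [x] is never reached: [lift i x] differs from [i], so its value differs from
    [s i]. *)
Definition delp_fun (n : nat) (i : 'I_n.+1) (s : 'S_n.+1) (x : 'I_n) : 'I_n :=
  odflt x (unlift (s i) (s (lift i x))).

Lemma delp_funK (n : nat) (i : 'I_n.+1) (s : 'S_n.+1) (x : 'I_n) :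
  lift (s i) (delp_fun i s x) = s (lift i x).
Proof.
rewrite /delp_fun; case: unliftP => [y ->//|/perm_inj/eqP].
by rewrite eq_sym (negPf (neq_lift _ _)).
Qed.

Lemma delp_fun_inj (n : nat) (i : 'I_n.+1) (s : 'S_n.+1) :
  injective (delp_fun i s).
Proof.
move=> x y /(congr1 (lift (s i))); rewrite !delp_funK => /perm_inj.
exact: lift_inj.
Qed.

Definition delp (n : nat) (i : 'I_n.+1) (s : 'S_n.+1) : 'S_n :=
  perm (@delp_fun_inj n i s).

Lemma delpE (n : nat) (i : 'I_n.+1) (s : 'S_n.+1) (x : 'I_n) :
  delp i s x = delp_fun i s x.
Proof. exact: permE. Qed.

Lemma delpK (n : nat) (i : 'I_n.+1) (s : 'S_n.+1) :
  lift_perm i (s i) (delp i s) = s.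
Proof.
apply/permP=> x; case: (unliftP i x) => [y|] ->; last by rewrite lift_perm_id.
by rewrite lift_perm_lift delpE delp_funK.
Qed.

Lemma delp_lift (n : nat) (i v : 'I_n.+1) (s : 'S_n) :
  delp i (lift_perm i v s) = s.
Proof.
apply/permP=> x; apply: (@lift_inj _ v).
have := delp_funK i (lift_perm i v s) x.
by rewrite lift_perm_id lift_perm_lift delpE.
Qed.

(* [i0] is the letter of [t] played by the new point; [y i0] is meaningless. *)
Lemma contains_lift (n k : nat) (t : 'S_k) (s : 'S_n) (i v : 'I_n.+1) :
  1 < k -> contains (lift_perm i v s) t ->
  contains s t \/
  exists (i0 : 'I_k) (y : 'I_k -> 'I_n),
    [/\ forall j, j != i0 -> (y j < i) = (j < i0),
        forall j, j != i0 -> (s (y j) < v) = (t j < t i0),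
        forall j j' : 'I_k, j != i0 -> j' != i0 -> j < j' -> y j < y j' &
        forall j j' : 'I_k, j != i0 -> j' != i0 ->
          (s (y j) < s (y j')) = (t j < t j')].
Proof.
move=> k_gt1 /containsP[f [fpos fval]].
have lift_lt m (x : 'I_m.+1) (y : 'I_m) : (lift x y < x) = (y < x).
  by rewrite liftE; lia.
have lift_mono m (x : 'I_m.+1) (y z : 'I_m) : (lift x y < lift x z) = (y < z).
  by rewrite !liftE; lia.
have n_gt0 : 0 < n.
  have := fpos (Ordinal (ltnW k_gt1)) (Ordinal k_gt1) isT.
  by have := ltn_ord (f (Ordinal k_gt1)); lia.
have fpos' (j j' : 'I_k) : (f j < f j') = (j < j').
  have [/fpos//|/fpos|/val_inj->] := ltngtP j j'; last by rewrite ltnn.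
  by move=> /ltnW; rewrite leqNgt => /negbTE.
pose y j := odflt (Ordinal n_gt0) (unlift i (f j)).
have yP j : f j != i -> f j = lift i (y j).
  by rewrite /y; case: unliftP => [x -> //|->]; rewrite eqxx.
have [/existsP[i0 /eqP fi0]|/existsPn nof] := boolP [exists i0, f i0 == i].
- right; exists i0, y.
  have f_neq j : j != i0 -> f j = lift i (y j).
    move=> ji0; apply: yP; apply: contra ji0 => /eqP fj.
    by have := fpos' j i0; have := fpos' i0 j; rewrite fj fi0 ltnn; case: ltngtP => // /val_inj ->.
  split=> [j jn|j jn|j j' jn jn'|j j' jn jn'].
  + by rewrite -fpos' fi0 f_neq // lift_lt.
  + by rewrite -fval fi0 f_neq // lift_perm_lift lift_perm_id lift_lt.
  + by move=> /fpos; rewrite !f_neq // lift_mono.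
  + by rewrite -fval !f_neq // !lift_perm_lift lift_mono.
- left; apply/containsP; exists y; split=> [j j' /fpos|j j'].
    by rewrite (yP j) // (yP j') // lift_mono.
  by rewrite -fval (yP j) // (yP j') // !lift_perm_lift lift_mono.
Qed.

Lemma contains_lift_sub (n k : nat) (t : 'S_k) (s : 'S_n) (i v : 'I_n.+1) :
  contains s t -> contains (lift_perm i v s) t.
Proof.
move=> /containsP[f [fpos fval]]; apply/containsP.
exists (fun j => lift i (f j)); split=> [j j' /fpos|j j'].
  by rewrite !liftE; lia.
by rewrite -fval !lift_perm_lift !liftE; lia.
Qed.

(** * Decomposable patterns and reversal *)

Definition sum_dec (k : nat) (t : 'S_k) : Prop :=
  exists c, [/\ 0 < c, c < k & forall i j : 'I_k, i < c -> c <= j -> t i < t j].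

Definition skew_dec (k : nat) (t : 'S_k) : Prop :=
  exists c, [/\ 0 < c, c < k & forall i j : 'I_k, i < c -> c <= j -> t j < t i].

(** The first and the last letter of [t] would compare both ways. *)
Lemma sum_dec_not_skew (k : nat) (t : 'S_k) : sum_dec t -> ~ skew_dec t.
Proof.
move=> [c [c0 ck cP]] [d [d0 dk dP]].
have k0 : 0 < k by lia.
have k1 : k.-1 < k by lia.
have := cP (Ordinal k0) (Ordinal k1); have := dP (Ordinal k0) (Ordinal k1) => /=.
move=> /(_ d0) H1 /(_ c0) H2.
have : t (Ordinal k1) < t (Ordinal k0) by apply: H1; lia.
have : t (Ordinal k0) < t (Ordinal k1) by apply: H2; lia.
lia.
Qed.

Definition revp (n : nat) (s : 'S_n) : 'S_n := (perm (@rev_ord_inj n) * s)%g.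

Lemma revpE (n : nat) (s : 'S_n) (i : 'I_n) : revp s i = s (rev_ord i).
Proof. by rewrite permM permE. Qed.

Lemma revpK (n : nat) : involutive (@revp n).
Proof. by move=> s; apply/permP => i; rewrite !revpE rev_ordK. Qed.

Lemma contains_revp (n k : nat) (s : 'S_n) (t : 'S_k) :
  contains (revp s) (revp t) = contains s t.
Proof.
have aux m l (s' : 'S_m) (t' : 'S_l) :
    contains s' t' -> contains (revp s') (revp t').
  move=> /containsP[f [fpos fval]]; apply/containsP.
  exists (fun i => rev_ord (f (rev_ord i))); split=> [i j ij|i j].
    have : f (rev_ord j) < f (rev_ord i).
      by apply: fpos => /=; have := ltn_ord j; lia.
    by move=> /=; have := ltn_ord (f (rev_ord i)); lia.
  by rewrite !revpE !rev_ordK fval.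
apply/idP/idP; last exact: aux.
by move=> /aux; rewrite !revpK.
Qed.

Lemma card_avoiders_revp (n k : nat) (t : 'S_k) :
  #|avoiders n (revp t)| = #|avoiders n t|.
Proof.
rewrite -(card_imset _ (can_inj (@revpK n))); apply: eq_card => s.
rewrite mem_avoiders -(revpK s) mem_imset ?mem_avoiders; last exact: can_inj (@revpK n).
by rewrite -{1}(revpK s) contains_revp revpK.
Qed.

Lemma skew_dec_revp (k : nat) (t : 'S_k) : skew_dec t -> sum_dec (revp t).
Proof.
move=> [c [c0 ck cP]]; exists (k - c); split; [lia|lia|move=> i j ic jc].
by rewrite !revpE; apply: cP => /=; have := ltn_ord j; lia.
Qed.

Lemma sum_dec_revp (k : nat) (t : 'S_k) : sum_dec t -> skew_dec (revp t).
Proof.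
move=> [c [c0 ck cP]]; exists (k - c); split; [lia|lia|move=> i j ic jc].
by rewrite !revpE; apply: cP => /=; have := ltn_ord j; lia.
Qed.

(** * The ratio inequality *)

Lemma Cauchy_Schwarz_nat (T : finType) (A : {set T}) (F : T -> nat) :
  (\sum_(x in A) F x) ^ 2 <= #|A| * \sum_(x in A) F x ^ 2.
Proof.
rewrite -(leq_pmul2l (isT : 0 < 2)) expnS expn1.
have -> : 2 * ((\sum_(x in A) F x) * \sum_(x in A) F x) =
    \sum_(x in A) \sum_(y in A) 2 * (F x * F y).
  rewrite big_distrlr big_distrr /=; apply: eq_bigr => x _.
  by rewrite big_distrr.
have -> : 2 * (#|A| * \sum_(x in A) F x ^ 2) =
    \sum_(x in A) \sum_(y in A) (F x ^ 2 + F y ^ 2).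
  under [RHS]eq_bigr do rewrite big_split sum_nat_const /=.
  by rewrite big_split sum_nat_const /= -big_distrr /= mul2n addnn.
by apply: leq_sum => x _; apply: leq_sum => y _; exact: (nat_Cauchy (F x) (F y)).
Qed.

Section Insertion.
Variables (k : nat) (t : 'S_k).
(* [C s m v] is a property of the points of [s] at positions [< m] with values
   [< v]: a new point of value [v] is inserted at the last position [i] for
   which [C s i v] fails. *)
Variable C : forall n, 'S_n -> nat -> nat -> bool.

(** [C] will be monotone in the position, so this is where it switches to true; [i = n] covers the
    case that it never does. *)
Definition gap n (s : 'S_n) (v i : nat) :=
  ~~ C s i v && ((i == n) || C s i.+1 v).

(** The condition [gap] for the point at [i], read in the permutation that contains it; this point
    takes up a position itself, hence [i.+2] for [i.+1]. *)
Definition removable n (s : 'S_n.+1) (i : 'I_n.+1) :=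
  ~~ C s i (s i) && ((i == n :> nat) || C s i.+2 (s i)).

Hypothesis C0 : forall n (s : 'S_n) v, ~~ C s 0 v.
Hypothesis C_mono : forall n (s : 'S_n) m m' v, m <= m' -> C s m v -> C s m' v.
Hypothesis C_lift_le : forall n (s : 'S_n) (i v : 'I_n.+1) m, m <= i ->
  C (lift_perm i v s) m v = C s m v.
Hypothesis C_lift_ge : forall n (s : 'S_n) (i v : 'I_n.+1) m, i <= m ->
  C (lift_perm i v s) m.+1 v = C s m v.
Hypothesis removable_lift : forall n (s : 'S_n.+1) (j w : 'I_n.+2) (i : 'I_n.+1),
  removable (lift_perm j w s) j -> removable (lift_perm j w s) (lift j i) ->
  removable s i.
Hypothesis avoid_lift : forall n (s : 'S_n) (i v : 'I_n.+1),
  gap s v i -> ~~ contains s t -> ~~ contains (lift_perm i v s) t.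

Local Notation a n := #|avoiders n t|.
Local Notation A s := #|[set i | removable s i]|.

Lemma removable_gap n (s : 'S_n) (i v : 'I_n.+1) :
  removable (lift_perm i v s) i = gap s v i.
Proof.
rewrite /removable /gap lift_perm_id C_lift_le // C_lift_ge //.
Qed.

Lemma gap_uniq n (s : 'S_n) (v : nat) (i j : 'I_n.+1) :
  gap s v i -> gap s v j -> i = j.
Proof.
have aux (x y : 'I_n.+1) : gap s v x -> gap s v y -> x <= y.
  move=> /andP[xC _] /andP[_ /orP[/eqP ->|yC]]; first by rewrite -ltnS.
  by rewrite leqNgt; apply: contra xC => yx; apply: C_mono yC.
by move=> gi gj; apply/val_inj/eqP; rewrite eqn_leq !aux.
Qed.

Lemma gap_ex n (s : 'S_n) (v : nat) : exists i : 'I_n.+1, gap s v i.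
Proof.
have ex : exists i, (i == n) || C s i.+1 v by exists n; rewrite eqxx.
case: (ex_minnP ex) => i iP imin.
have ltin : i < n.+1 by rewrite ltnS imin // eqxx.
exists (Ordinal ltin); rewrite /gap /= iP andbT.
case: i {iP} imin ltin => [|i] imin _; first exact: C0.
by apply/negP => Ci; have := imin i; rewrite Ci orbT ltnn => /(_ isT).
Qed.

Lemma sum_gap n (s : 'S_n) (v x : nat) :
  \sum_(i < n.+1 | gap s v i) x = x.
Proof.
have [i0 g0] := gap_ex s v.
rewrite (big_pred1 i0) // => i; apply/idP/eqP => [gi|->//].
exact: gap_uniq gi g0.
Qed.

(** Deleting a removable point is inverse to inserting one at a gap. An avoider of size [n] arises
    once for each of the [n.+1] values, since each value has exactly one gap. *)
Lemma sum_removable n (F : 'S_n -> nat) :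
  \sum_(s in avoiders n.+1 t) \sum_(i | removable s i) F (delp i s) =
  n.+1 * \sum_(s in avoiders n t) F s.
Proof.
rewrite (exchange_big_dep predT) //=.
have reix (i : 'I_n.+1) : \sum_(s in avoiders n.+1 t | removable s i) F (delp i s) =
    \sum_(s in avoiders n t) \sum_(v : 'I_n.+1 | gap s v i) F s.
  rewrite pair_big_dep /=.
  rewrite (reindex_onto (fun p : 'S_n * 'I_n.+1 => lift_perm i p.2 p.1)
             (fun s => (delp i s, s i))) /=; last by move=> s _; exact: delpK.
  apply: eq_big => [[s v]|[s v] _] /=; last by rewrite delp_lift.
  rewrite delp_lift lift_perm_id eqxx andbT removable_gap !mem_avoiders.
  have [g|_] := boolP (gap s v i); last by rewrite !andbF.
  rewrite !andbT; apply/idP/idP; last exact: avoid_lift.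
  by apply: contra; exact: contains_lift_sub.
under eq_bigr do rewrite reix.
rewrite exchange_big /= big_distrr /=; apply: eq_bigr => s _.
rewrite (exchange_big_dep predT) //=.
by under eq_bigr do rewrite sum_gap; rewrite sum_nat_const card_ord.
Qed.

Lemma card_removable_del n (s : 'S_n.+2) (j : 'I_n.+2) :
  removable s j -> A s <= (A (delp j s)).+1.
Proof.
move=> rj; rewrite (cardsD1 j) inE rj add1n ltnS.
rewrite -(card_imset _ (@lift_inj _ j)); apply/subset_leq_card/fintype.subsetP => i.
rewrite !inE; case: (unliftP j i) => [i0|] ->; last by rewrite eqxx.
move=> /andP[_ ri]; rewrite mem_imset ?inE; last exact: lift_inj.
by apply: (@removable_lift _ _ j (s j)); rewrite delpK.
Qed.

Lemma avoiders_ratio_ineq n :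
  n.+2 * a n.+1 ^ 2 <= a n.+2 * (n.+1 * a n + a n.+1).
Proof.
have sumA m : \sum_(s in avoiders m.+1 t) A s = m.+1 * a m.
  rewrite -sum1_card -sum_removable; apply: eq_bigr => s _.
  by rewrite sum1_card; apply: eq_card => i; rewrite inE.
(* Write [A s ^ 2] as the sum of [A s] over the removable points [i], and bound each term by
   [(A (delp i s)).+1]. *)
have sumA2 : \sum_(s in avoiders n.+2 t) A s ^ 2 <=
    n.+2 * (n.+1 * a n + a n.+1).
  rewrite mulnDr -!sumA -sum_removable.
  rewrite -big_split /=; apply: leq_sum => s _.
  rewrite -[X in _ <= _ + X]sum1_card expnS expn1 -{1}sum1_card.
  rewrite big_distrl /= (eq_bigl (removable s)); last by move=> i; rewrite inE.
  rewrite [X in _ <= _ + X](eq_bigl (removable s)); last by move=> i; rewrite inE.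
  rewrite -big_split /=; apply: leq_sum => i ri.
  by rewrite mul1n addn1 card_removable_del.
rewrite -(leq_pmul2l (ltn0Sn n.+1)).
have := Cauchy_Schwarz_nat (avoiders n.+2 t) (fun s => A s).
rewrite sumA => /leq_trans; move=> /(_ _ (leq_mul (leqnn _) sumA2)).
by nia.
Qed.

End Insertion.

(** * Insertion for sum-decomposable patterns *)

Section PrefixInsertion.
Variables (k : nat) (t : 'S_k) (c : nat).

(** The map [e] is total on ['I_k] but constrained only on the first [c] letters, so the prefix need
    not be made a permutation of its own. *)
Definition prefix_occurs n (s : 'S_n) (m v : nat) : bool :=
  `[< exists e : 'I_k -> 'I_n,
      [/\ forall i j : 'I_k, i < c -> j < c -> i < j -> e i < e j,
          forall i j : 'I_k, i < c -> j < c -> (s (e i) < s (e j)) = (t i < t j) &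
          forall i : 'I_k, i < c -> e i < m /\ s (e i) < v] >].

Hypotheses (c_gt0 : 0 < c) (ck : c < k).

Let k_gt0 : 0 < k. Proof. exact: leq_ltn_trans ck. Qed.

Lemma prefix_occurs0 n (s : 'S_n) v : ~~ prefix_occurs s 0 v.
Proof. by apply/asboolP => -[e [_ _ /(_ (Ordinal k_gt0) c_gt0)[]]]. Qed.

Lemma prefix_occurs_mono n (s : 'S_n) m m' v v' :
  m <= m' -> v <= v' -> prefix_occurs s m v -> prefix_occurs s m' v'.
Proof.
move=> mm vv /asboolP[e [e1 e2 e3]]; apply/asboolP; exists e; split=> // i /e3.
by lia.
Qed.

(** The value at [x] is too large for the occurrence to use position [x]. *)
Lemma prefix_occurs_skip n (s : 'S_n) (x : 'I_n) v :
  v <= s x -> prefix_occurs s x.+1 v -> prefix_occurs s x v.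
Proof.
move=> vx /asboolP[e [e1 e2 e3]]; apply/asboolP; exists e; split=> // i /e3[ex ev].
split=> //; rewrite ltn_neqAle -ltnS ex andbT; apply/eqP => /val_inj exE.
by move: ev; rewrite exE ltnNge vx.
Qed.

Lemma prefix_occurs_up n (s : 'S_n) (j w : 'I_n.+1) m v m' v' :
  (forall x, x < m -> (j <= x) + x < m') ->
  (forall x, x < v -> (w <= x) + x < v') ->
  prefix_occurs s m v -> prefix_occurs (lift_perm j w s) m' v'.
Proof.
move=> mm vv /asboolP[e [e1 e2 e3]]; apply/asboolP.
exists (fun i => lift j (e i)); split=> [i i' ic ic' ii|i i' ic ic'|i ic].
- by have := e1 _ _ ic ic' ii; rewrite !liftE; lia.
- by rewrite -(e2 _ _ ic ic') !lift_perm_lift !liftE; lia.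
- by have [/mm ? /vv ?] := e3 _ ic; rewrite lift_perm_lift !liftE.
Qed.

(** The first condition keeps the new point outside the window, so the occurrence uses old points
    only. *)
Lemma prefix_occurs_down n (s : 'S_n) (j w : 'I_n.+1) m v m' v' :
  (m' <= j) || (v' <= w) ->
  (forall x, (j <= x) + x < m' -> x < m) ->
  (forall x, (w <= x) + x < v' -> x < v) ->
  prefix_occurs (lift_perm j w s) m' v' -> prefix_occurs s m v.
Proof.
move=> out mm vv /asboolP[e [e1 e2 e3]]; apply/asboolP.
have ej (i : 'I_k) : i < c -> e i != j.
  by move=> /e3[H1 H2]; apply/eqP => E; move: H1 H2; rewrite E lift_perm_id; lia.
have n_gt0 : 0 < n.
  have := ej _ (c_gt0 : Ordinal k_gt0 < c).
  case: (unliftP j (e (Ordinal k_gt0))) => [x _ _|->].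
    exact: leq_ltn_trans (ltn_ord x).
  by rewrite eqxx.
pose y i := odflt (Ordinal n_gt0) (unlift j (e i)).
have yP (i : 'I_k) : i < c -> e i = lift j (y i).
  by move=> /ej; rewrite /y; case: unliftP => [x -> //|->]; rewrite eqxx.
exists y; split=> [i i' ic ic' ii|i i' ic ic'|i ic].
- by have := e1 _ _ ic ic' ii; rewrite (yP i) // (yP i') // !liftE; lia.
- rewrite -(e2 _ _ ic ic') (yP i) // (yP i') // !lift_perm_lift !liftE; lia.
- by have := e3 _ ic; rewrite (yP i) // lift_perm_lift !liftE => -[/mm ? /vv ?].
Qed.

Lemma prefix_removable_lift n (s : 'S_n.+1) (j w : 'I_n.+2) (i : 'I_n.+1) :
  removable prefix_occurs (lift_perm j w s) j ->
  removable prefix_occurs (lift_perm j w s) (lift j i) ->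
  removable prefix_occurs s i.
Proof.
rewrite /removable lift_perm_id lift_perm_lift !liftE.
have [jn wn iN siN] := And4 (ltn_ord j) (ltn_ord w) (ltn_ord i) (ltn_ord (s i)).
move=> /andP[Cj Lj] /andP[Ci Li]; apply/andP; split.
  by apply: contra Ci; apply: prefix_occurs_up => x; lia.
case/orP: Li => [iE|Li]; first by apply/orP; left; lia.
(* If [s i] is below [w], or the window of [Li] ends before [j], the occurrence in [Li] avoids the
   new point and survives its deletion. *)
have [wv|wv] := ltnP (s i) w.
  apply/orP; right; apply: prefix_occurs_down Li; [|move=> x; lia..].
  by apply/orP; right; lia.
have [ji|ji] := leqP ((j <= i) + i).+2 j.
  apply/orP; right; apply: prefix_occurs_down Li; [|move=> x; lia..].
  by apply/orP; left.
(* Now the new point is lower and at most one place to the right of [i]; the occurrence in [Lj],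
   below [w], is used instead. *)
case/orP: Lj => [jE|Lj]; first by apply/orP; left; lia.
have {}Lj : prefix_occurs s j.+1 w.
  by apply: prefix_occurs_down Lj; [rewrite leqnn orbT|move=> x; lia..].
have [jE|ij] : j = i.+1 :> nat \/ j <= i by lia.
  by apply/orP; right; move: Lj; rewrite jE; apply: prefix_occurs_mono.
(* For [j <= i] that occurrence cannot use position [i], whose value is at least [w]; so it lies
   before and below the point [i], against [Ci]. *)
case/negP: Ci; apply: (@prefix_occurs_up _ _ _ _ i w); [move=> x; lia..|].
apply: prefix_occurs_skip => //.
exact: prefix_occurs_mono Lj.
Qed.

Hypothesis t_dec : forall i j : 'I_k, i < c -> c <= j -> t i < t j.

(** If the new point plays a letter beyond the prefix, the prefix occurs before and below it,
    against the choice of the gap. If it plays a prefix letter, the occurrence completed at the gap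
    replaces the whole prefix. *)
Lemma prefix_avoid_lift n (s : 'S_n) (i v : 'I_n.+1) :
  gap prefix_occurs s v i -> ~~ contains s t -> ~~ contains (lift_perm i v s) t.
Proof.
move=> /andP[Ci Li] st; apply/negP => /(contains_lift (leq_ltn_trans c_gt0 ck))[].
  by apply/negP.
move=> [i0 [y [y1 y2 y3 y4]]].
have neq (x z : 'I_k) : x < c -> c <= z -> x != z.
  by move=> xc cz; apply: contraTneq xc => ->; rewrite -leqNgt.
have [i0c|ci0] := ltnP i0 c; last first.
  case/negP: Ci; apply/asboolP; exists y.
  split=> [j j' jc jc'|j j' jc jc'|j jc]; [exact: y3 (neq _ _ _ _) (neq _ _ _ _)|
    exact: y4 (neq _ _ _ _) (neq _ _ _ _)|].
  have jn := neq _ _ jc ci0; rewrite y1 // y2 // t_dec //; lia.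
have ybig (j : 'I_k) : c <= j -> i <= y j /\ v <= s (y j).
  move=> cj; have jn : j != i0 by rewrite eq_sym neq.
  have := y1 j jn; have := y2 j jn; have := t_dec i0c cj; lia.
case/orP: Li => [/eqP iE|/asboolP[e [e1 e2 e3]]].
  by have [] := ybig (Ordinal ck) (leqnn _); rewrite iE leqNgt ltn_ord.
case/negP: st; apply/containsP.
exists (fun j : 'I_k => if j < c then e j else y j); split=> j j'.
- case: (ltnP j c) => jc; case: (ltnP j' c) => jc' jj; [exact: e1| |lia|].
    have [ei se] := e3 _ jc; have [yi sy] := ybig _ jc'.
    (* The bounds give only [e j <= i <= y j']; equality is excluded as [v] separates the values. *)
    rewrite ltn_neqAle; apply/andP; split; last lia.
    by apply/eqP => /val_inj E; move: se sy; rewrite E; lia.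
  by apply: y3 => //; rewrite eq_sym neq.
- case: (ltnP j c) => jc; case: (ltnP j' c) => jc'; [exact: e2| | |].
  + have [? ?] := e3 _ jc; have [? ?] := ybig _ jc'.
    by have := t_dec jc jc'; lia.
  + have [? ?] := e3 _ jc'; have [? ?] := ybig _ jc.
    by have := t_dec jc' jc; lia.
  + by apply: y4; rewrite eq_sym neq.
Qed.

Lemma sum_dec_ratio_ineq_at n :
  n.+2 * #|avoiders n.+1 t| ^ 2 <=
  #|avoiders n.+2 t| * (n.+1 * #|avoiders n t| + #|avoiders n.+1 t|).
Proof.
apply: (@avoiders_ratio_ineq _ _ prefix_occurs).
- exact: prefix_occurs0.
- by move=> m s m' m'' v mm; apply: prefix_occurs_mono.
- move=> m s i v m' mi; apply/idP/idP.
    by apply: prefix_occurs_down => [|x|x]; lia.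
  by apply: prefix_occurs_up => x; lia.
- move=> m s i v m' mi; apply/idP/idP.
    by apply: prefix_occurs_down => [|x|x]; lia.
  by apply: prefix_occurs_up => x; lia.
- exact: prefix_removable_lift.
- exact: prefix_avoid_lift.
Qed.

End PrefixInsertion.

(** * Insertion in front of the preceding value *)

Section Doubling.
Variables (k : nat) (t : 'S_k).

(** With this [C] the gap is the position of the value [v-1], so the new point comes just before it;
    for [v = 0] the predicate never holds and the new point goes to the end. *)
Definition pred_occurs n (s : 'S_n) (m v : nat) : bool :=
  [exists x : 'I_n, (x < m) && ((s x).+1 == v)].

Lemma pred_occursP n (s : 'S_n) m v :
  reflect (exists x : 'I_n, x < m /\ (s x).+1 = v) (pred_occurs s m v).
Proof.
apply: (iffP existsP) => -[x]; first by move=> /andP[xm /eqP sx]; exists x.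
by move=> [xm sx]; exists x; rewrite xm sx eqxx.
Qed.

Lemma pred_occurs_lift_witness n (s : 'S_n) (j w : 'I_n.+1) m v :
  pred_occurs (lift_perm j w s) m v ->
  (j < m /\ w.+1 = v) \/
  exists y : 'I_n, (j <= y) + y < m /\ ((w <= s y) + s y).+1 = v.
Proof.
move=> /pred_occursP[x]; case: (unliftP j x) => [y|] ->.
  by rewrite lift_perm_lift !liftE; right; exists y.
by rewrite lift_perm_id; left.
Qed.

Lemma pred_occurs_lift_old n (s : 'S_n) (j w : 'I_n.+1) m v (y : 'I_n) :
  (j <= y) + y < m -> ((w <= s y) + s y).+1 = v ->
  pred_occurs (lift_perm j w s) m v.
Proof.
move=> ym yv; apply/pred_occursP; exists (lift j y).
by rewrite lift_perm_lift !liftE.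
Qed.

Lemma pred_occurs_lift_new n (s : 'S_n) (j w : 'I_n.+1) m v :
  j < m -> w.+1 = v -> pred_occurs (lift_perm j w s) m v.
Proof. by move=> jm wv; apply/pred_occursP; exists j; rewrite lift_perm_id. Qed.

(** A point is removable when its preceding value follows it directly, or when it is the least value
    in last place. The delicate case is the deletion of the middle of a run [w+1, w, w-1]. *)
Lemma pred_removable_lift n (s : 'S_n.+1) (j w : 'I_n.+2) (i : 'I_n.+1) :
  removable pred_occurs (lift_perm j w s) j ->
  removable pred_occurs (lift_perm j w s) (lift j i) ->
  removable pred_occurs s i.
Proof.
rewrite /removable lift_perm_id lift_perm_lift !liftE.
have [jn wn iN siN] := And4 (ltn_ord j) (ltn_ord w) (ltn_ord i) (ltn_ord (s i)).
move=> /andP[Cj Lj] /andP[Ci Li]; apply/andP; split.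
  apply/pred_occursP => -[y [yi yv]].
  have [wE|wE] := eqVneq (w : nat) (s i).
    have ij : i < j.
      rewrite ltnNge; apply: contra Ci => ji.
      by apply: pred_occurs_lift_new; lia.
    by case/negP: Cj; apply: (@pred_occurs_lift_old _ _ _ _ _ _ y); lia.
  by case/negP: Ci; apply: (@pred_occurs_lift_old _ _ _ _ _ _ y); lia.
case/orP: Li => [iE|Li]; first by apply/orP; left; lia.
(* If the new point witnesses [Li], it sits right after [i]; once it is gone, its own predecessor
   [z] follows [i], or [i] is last. *)
case/pred_occurs_lift_witness: Li => [[ji wv]|[y [yi yv]]].
- have jE : j = i.+1 :> nat.
    suff: ~~ (j <= i) by lia.
    by apply: contra Ci => ji'; apply: pred_occurs_lift_new; lia.
  case/orP: Lj => [jE'|]; first by apply/orP; left; lia.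
  move=> /pred_occurs_lift_witness[|[z [zj zw]]]; first lia.
  by apply/orP; right; apply/pred_occursP; exists z; lia.
- by apply/orP; right; apply/pred_occursP; exists y; lia.
Qed.

Definition no_descent_adjacency :=
  forall i j : 'I_k, j = i.+1 :> nat -> t i = (t j).+1 :> nat -> False.

Hypotheses (k_gt1 : 1 < k) (t_adj : no_descent_adjacency) (t_skew : ~ skew_dec t).

(** An occurrence using both the new point and the [v-1] behind it would show adjacent letters
    [j+1, j] in [t]. If it does not use [v-1], that point can stand in for the new one. *)
Lemma pred_avoid_lift n (s : 'S_n) (i v : 'I_n.+1) :
  gap pred_occurs s v i -> ~~ contains s t -> ~~ contains (lift_perm i v s) t.
Proof.
move=> /andP[Ci Li] st; apply/negP => /(contains_lift k_gt1)[].
  by apply/negP.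
move=> [i0 [y [y1 y2 y3 y4]]].
have t_neq (j j' : 'I_k) : j != j' -> t j != t j' :> nat.
  by apply: contra => /eqP/val_inj/perm_inj ->.
(* A new minimum in last place would make [t] end with its least letter, hence skew-decomposable. *)
have [/eqP v0|v_gt0] := posnP v.
  have {Li} iE : i = n :> nat.
    by case/orP: Li => [/eqP//|/pred_occursP[x []]]; rewrite (eqP v0).
  have last (j : 'I_k) : j != i0 -> j < i0 /\ t i0 < t j.
    move=> ji; rewrite -y1 // iE ltn_ord; split=> //.
    have := y2 j ji; rewrite (eqP v0) ltn0 => /esym/negbT.
    by rewrite -leqNgt leq_eqVlt eq_sym (negPf (t_neq _ _ ji)).
  have i0E : i0.+1 = k.
    apply/eqP; rewrite eqn_leq ltn_ord leqNgt; apply/negP => ik.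
    have /last[] : Ordinal ik != i0 by rewrite -val_eqE /=; lia.
    by rewrite /=; lia.
  case: t_skew; exists k.-1; split; [lia|lia|move=> a b ak bk].
  have -> : b = i0 by apply: ord_inj; have := ltn_ord b; lia.
  by apply last; apply/eqP => aE; move: ak; rewrite aE; lia.
have [q qv] : exists q : 'I_n, (s q).+1 = v.
  have vn : v.-1 < n by have := ltn_ord v; lia.
  by exists ((s^-1)%g (Ordinal vn)); rewrite permKV /=; lia.
have qi : q = i :> nat.
  apply/eqP; rewrite eqn_leq; apply/andP; split.
    case/orP: Li => [/eqP ->|/pred_occursP[x [xi xv]]]; first exact: ltnW.
    suff -> : q = x by [].
    by apply: (@perm_inj _ s); apply: ord_inj; lia.
  rewrite leqNgt; apply: contra Ci => qi; apply/pred_occursP; by exists q.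
have [/existsP[j1 /andP[j1i /eqP yq]]|/existsPn noq] :=
    boolP [exists j1, (j1 != i0) && (y j1 == q)].
- have ij1 : i0 < j1.
    have := y1 _ j1i; rewrite yq qi ltnn => /esym/negbT.
    by rewrite -leqNgt leq_eqVlt val_eqE eq_sym (negPf j1i).
  have tj1 : t j1 < t i0 by rewrite -y2 // yq; lia.
  have j1E : j1 = i0.+1 :> nat.
    apply/eqP; rewrite eqn_leq ij1 andbT leqNgt; apply/negP => ltj.
    have jk : i0.+1 < k by exact: ltn_trans (ltn_ord j1).
    have jn : Ordinal jk != i0 by rewrite -val_eqE /=; lia.
    have := y3 (Ordinal jk) j1 jn j1i ltj; rewrite yq qi (y1 _ jn) /=; lia.
  apply: (@t_adj i0 j1) => //; apply/eqP; rewrite eqn_leq tj1 andbT leqNgt.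
  apply/negP => ltt.
  have vk : (t j1).+1 < k by exact: ltn_trans (ltn_ord (t i0)).
  pose j := (t^-1)%g (Ordinal vk).
  have tj : t j = (t j1).+1 :> nat by rewrite permKV.
  have jn : j != i0 by apply/eqP => E; move: ltt; rewrite -tj E ltnn.
  have := y2 j jn; have := y4 j1 j j1i jn; rewrite yq tj; lia.
- case/negP: st; apply/containsP.
  have yn (j : 'I_k) : j != i0 -> (y j != q :> nat) /\ (s (y j) != s q :> nat).
    move=> ji; have := noq j; rewrite ji /= => yq; split=> //.
    by apply: contra yq => /eqP/val_inj/perm_inj ->.
  exists (fun j => if j == i0 then q else y j); split=> j j'.
  + case: eqVneq => [->|jn]; case: eqVneq => [->|jn']; [by rewrite ltnn| | |exact: y3].
      by have [] := yn _ jn'; have := y1 _ jn'; lia.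
    by have [] := yn _ jn; have := y1 _ jn; lia.
  + case: eqVneq => [->|jn]; case: eqVneq => [->|jn']; [by rewrite !ltnn| | |exact: y4].
      by have [] := yn _ jn'; have := y2 _ jn'; have := t_neq _ _ jn'; lia.
    by have [] := yn _ jn; have := y2 _ jn; have := t_neq _ _ jn; lia.
Qed.

Lemma no_descent_ratio_ineq n :
  n.+2 * #|avoiders n.+1 t| ^ 2 <=
  #|avoiders n.+2 t| * (n.+1 * #|avoiders n t| + #|avoiders n.+1 t|).
Proof.
apply: (@avoiders_ratio_ineq _ _ pred_occurs).
- by move=> m s v; apply/pred_occursP => -[x []].
- move=> m s m' m'' v mm /pred_occursP[x [xm xv]]; apply/pred_occursP.
  by exists x; split=> //; apply: leq_trans mm.
- move=> m s i v m' mi; apply/idP/idP => [/pred_occurs_lift_witness[|[y [ym yv]]]|].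
  + lia.
  + by apply/pred_occursP; exists y; lia.
  + by move=> /pred_occursP[y [ym yv]]; apply: (@pred_occurs_lift_old _ _ _ _ _ _ y); lia.
- move=> m s i v m' mi; apply/idP/idP => [/pred_occurs_lift_witness[|[y [ym yv]]]|].
  + lia.
  + by apply/pred_occursP; exists y; lia.
  + by move=> /pred_occursP[y [ym yv]]; apply: (@pred_occurs_lift_old _ _ _ _ _ _ y); lia.
- exact: pred_removable_lift.
- exact: pred_avoid_lift.
Qed.

End Doubling.

(** * Supermultiplicativity and left-to-right maxima *)

Definition dsum_fun (m n : nat) (s : 'S_m) (s' : 'S_n) (i : 'I_(m + n)) : 'I_(m + n) :=
  match fintype.split i with
  | inl a => lshift n (s a)
  | inr b => rshift m (s' b)
  end.

Lemma dsum_fun_l m n (s : 'S_m) (s' : 'S_n) a :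
  dsum_fun s s' (lshift n a) = lshift n (s a).
Proof. by rewrite /dsum_fun (unsplitK (inl a)). Qed.

Lemma dsum_fun_r m n (s : 'S_m) (s' : 'S_n) b :
  dsum_fun s s' (rshift m b) = rshift m (s' b).
Proof. by rewrite /dsum_fun (unsplitK (inr b)). Qed.

Lemma dsum_fun_inj m n (s : 'S_m) (s' : 'S_n) : injective (dsum_fun s s').
Proof.
move=> i j; rewrite -(splitK i) -(splitK j).
case: (fintype.split i) => a; case: (fintype.split j) => b /=;
  rewrite ?dsum_fun_l ?dsum_fun_r => /(congr1 val) /= E.
- by congr (lshift _ _); apply: (@perm_inj _ s); apply: ord_inj.
- by have := ltn_ord (s a); lia.
- by have := ltn_ord (s b); lia.
- by congr (rshift _ _); apply: (@perm_inj _ s'); apply: ord_inj; lia.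
Qed.

Definition dsum (m n : nat) (s : 'S_m) (s' : 'S_n) : 'S_(m + n) :=
  perm (@dsum_fun_inj m n s s').

Lemma dsum_l m n (s : 'S_m) (s' : 'S_n) a : dsum s s' (lshift n a) = lshift n (s a).
Proof. by rewrite permE dsum_fun_l. Qed.

Lemma dsum_r m n (s : 'S_m) (s' : 'S_n) b : dsum s s' (rshift m b) = rshift m (s' b).
Proof. by rewrite permE dsum_fun_r. Qed.

Lemma dsum_ltl m n (s : 'S_m) (s' : 'S_n) (i : 'I_(m + n)) : (dsum s s' i < m) = (i < m).
Proof.
rewrite -(splitK i); case: (fintype.split i) => a /=.
  by rewrite dsum_l /= !ltn_ord.
by rewrite dsum_r /=; lia.
Qed.

Lemma dsum_inj m n (s1 s2 : 'S_m) (s1' s2' : 'S_n) :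
  dsum s1 s1' = dsum s2 s2' -> s1 = s2 /\ s1' = s2'.
Proof.
move=> E; split; apply/permP => x.
  by apply: (@lshift_inj _ n); rewrite -(dsum_l s1 s1') E dsum_l.
by apply: (@rshift_inj m); rewrite -(dsum_r s1 s1') E dsum_r.
Qed.

(** An occurrence meeting both blocks splits [t] as a direct sum at [c], the first letter sent to
    the second block. *)
Lemma contains_dsum (m n k : nat) (t : 'S_k) (s : 'S_m) (s' : 'S_n) :
  ~ sum_dec t -> contains (dsum s s') t -> contains s t \/ contains s' t.
Proof.
move=> t_ind /containsP[f [fpos fval]].
have [/existsP[j0 j0m]|/existsPn allm] := boolP [exists j, m <= f j]; last first.
  have /fin_all_exists[y yP] (i : 'I_k) : exists x, f i = lshift n x.
    have im : f i < m by rewrite ltnNge allm.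
    by exists (Ordinal im); apply: ord_inj.
  left; apply/containsP; exists y; split=> [i j /fpos|i j]; first by rewrite !yP.
  by rewrite -fval !yP !dsum_l.
have [/existsP[i0 i0m]|/existsPn alln] := boolP [exists j, f j < m]; last first.
  have /fin_all_exists[y yP] (i : 'I_k) : exists x, f i = rshift m x.
    have im : f i - m < n by have := alln i; have := ltn_ord (f i); lia.
    by exists (Ordinal im); apply: ord_inj => /=; have := alln i; lia.
  right; apply/containsP; exists y; split=> [i j /fpos|i j].
    by rewrite !yP /= ltn_add2l.
  by rewrite -fval !yP !dsum_r /= ltn_add2l.
case: (@arg_minnP _ j0 (fun j : 'I_k => m <= f j) (@nat_of_ord k) j0m) => c cm cmin.
have below (i : 'I_k) : i < c -> f i < m.
  by move=> ic; rewrite ltnNge; apply/negP => /cmin; rewrite leqNgt ic.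
have above (j : 'I_k) : c <= j -> m <= f j.
  by rewrite leq_eqVlt => /orP[/eqP/ord_inj <- //|/fpos/ltnW]; apply: leq_trans.
case: t_ind; exists c; split=> //.
  rewrite (leq_ltn_trans (leq0n i0)) // ltnNge; apply/negP => /above.
  by rewrite leqNgt i0m.
move=> i j /below fi /above fj; rewrite -fval.
apply: (@leq_trans m); first by rewrite dsum_ltl.
by rewrite leqNgt dsum_ltl -leqNgt.
Qed.

(** For a sum-indecomposable [t], [dsum] maps pairs of avoiders to avoiders. Otherwise the reverse
    of [t] is skew-decomposable, hence sum-indecomposable. *)
Lemma avoiders_supermul (m n k : nat) (t : 'S_k) :
  #|avoiders m t| * #|avoiders n t| <= #|avoiders (m + n) t|.
Proof.
wlog t_ind : t / ~ sum_dec t.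
  have [t_sum|t_ind] := pselect (sum_dec t); last exact.
  move=> H; rewrite -(card_avoiders_revp m) -(card_avoiders_revp n).
  rewrite -(card_avoiders_revp (m + n)); apply: H => /sum_dec_not_skew.
  by apply; exact: sum_dec_revp.
rewrite -cardsX.
rewrite -(@card_in_imset _ _ (fun p : 'S_m * 'S_n => dsum p.1 p.2)); last first.
  by move=> [a b] [a' b'] _ _ /= /dsum_inj[-> ->].
apply/subset_leq_card/fintype.subsetP => _ /imsetP[[a b] /setXP[]] /= + + ->.
rewrite !mem_avoiders => at_ bt; apply/negP => /(contains_dsum t_ind)[]; exact/negP.
Qed.

(** * Extending avoiders at left-to-right maxima *)

Definition lr_max (n : nat) (s : 'S_n) (q : 'I_n) : bool :=
  [forall j : 'I_n, (j < q) ==> (s j < s q)].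

Lemma lr_maxP (n : nat) (s : 'S_n) (q : 'I_n) :
  reflect (forall j : 'I_n, j < q -> s j < s q) (lr_max s q).
Proof.
by apply: (iffP forallP) => H j; [exact/implyP|exact/implyP/H].
Qed.

(** The sum counts pairs of an avoider and one of its left-to-right maxima; [h] embeds these pairs
    into the larger avoiders. *)
Lemma sum_LR_le (n k : nat) (t : 'S_k) (h : 'S_n -> 'I_n -> 'S_n.+1) :
  (forall s s' q q', h s q = h s' q' -> s = s' /\ q = q') ->
  (forall s q, ~~ contains s t -> lr_max s q -> ~~ contains (h s q) t) ->
  \sum_(s in avoiders n t) LR s <= #|avoiders n.+1 t|.
Proof.
move=> h_inj h_av.
pose P := [set p : 'S_n * 'I_n | (p.1 \in avoiders n t) && lr_max p.1 p.2].
have -> : \sum_(s in avoiders n t) LR s = #|P|.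
  rewrite -sum1dep_card -(pair_big_dep _ _ (fun _ _ => 1%N)) /=.
  by apply: eq_bigr => s _; rewrite sum1dep_card.
rewrite -(@card_in_imset _ _ (fun p => h p.1 p.2)); last first.
  by move=> [a b] [a' b'] _ _ /= /h_inj[-> ->].
apply/subset_leq_card/fintype.subsetP => _ /imsetP[[s q] + ->].
by rewrite inE => /andP[] /=; rewrite !mem_avoiders; exact: h_av.
Qed.

(** Prepend the value just above [s q]. In an occurrence through the new point, the second letter
    exceeds [s q] and so lies after [q], as do all later ones; [q] can then play the first
    letter. *)
Lemma sum_LR_ascent (n k : nat) (t : 'S_k) : starts_with_ascent t ->
  \sum_(s in avoiders n t) LR s <= #|avoiders n.+1 t|.
Proof.
move=> [a [b [/= a0 b1 tab]]].
have k_gt1 : 1 < k by have := ltn_ord b; rewrite b1.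
apply: (@sum_LR_le _ _ _ (fun s q => lift_perm ord0 (lift ord0 (s q)) s)).
  move=> s s' q q' E.
  have Es : s = s' by rewrite -(delp_lift ord0 (lift ord0 (s q)) s) E delp_lift.
  split=> //; have := congr1 (fun u : 'S_n.+1 => u ord0) E.
  by rewrite /= !lift_perm_id Es => /lift_inj/perm_inj.
move=> s q st /lr_maxP qmax; apply/negP => /(contains_lift k_gt1)[]; first exact/negP.
move=> [i0 [y [y1 y2 y3 y4]]].
have i0E : i0 = a.
  apply/eqP; rewrite eq_sym; apply/negPn/negP => ai; have := y1 _ ai.
  by move: ai; rewrite -val_eqE /= a0; lia.
move: i0E y1 y2 y3 y4 => -> {i0} y1 y2 y3 y4.
have ba : b != a by rewrite -val_eqE /= a0 b1.
have yb : q < y b.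
  have sb : s q < s (y b) by have := y2 _ ba; rewrite liftE /=; lia.
  rewrite ltnNge leq_eqVlt; apply/negP => /orP[/eqP/ord_inj E|/qmax]; last lia.
  by move: sb; rewrite E ltnn.
have yq (j : 'I_k) : j != a -> q < y j.
  move=> ja; have [->//|jb] := eqVneq j b.
  apply: ltn_trans yb _; apply: y3 => //; move: ja jb; rewrite -!val_eqE /= a0 b1; lia.
have sneq (j : 'I_k) : j != a -> s (y j) != s q :> nat.
  by move=> /yq; apply: contraTneq => /ord_inj/perm_inj ->; rewrite ltnn.
have tneq (j : 'I_k) : j != a -> t j != t a :> nat.
  by apply: contra => /eqP/ord_inj/perm_inj ->.
case/negP: st; apply/containsP.
exists (fun j => if j == a then q else y j); split=> j j'.
- case: eqVneq => [->|jn]; case: eqVneq => [->|jn']; [by rewrite ltnn| | |exact: y3].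
    by rewrite yq.
  by rewrite a0.
- case: eqVneq => [->|jn]; case: eqVneq => [->|jn']; [by rewrite !ltnn| | |exact: y4].
    by have := y2 _ jn'; have := sneq _ jn'; have := tneq _ jn'; rewrite liftE /=; lia.
  by have := y2 _ jn; have := sneq _ jn; have := tneq _ jn; rewrite liftE /=; lia.
Qed.

(** Put a new maximum just before [q]. It can only play the largest letter; the second largest lies
    before [q], hence below [s q], and so do all others in value. Thus [q] can replace the new
    maximum. *)
Lemma sum_LR_max_right (n k : nat) (t : 'S_k) : max_right_of_submax t ->
  \sum_(s in avoiders n t) LR s <= #|avoiders n.+1 t|.
Proof.
move=> [a [b [ta tb ab]]].
have k_gt1 : 1 < k by rewrite -ta.
apply: (@sum_LR_le _ _ _ (fun s q => lift_perm (lift ord_max q) ord_max s)).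
  move=> s s' q q' E.
  have Eq : q = q'.
    apply: (@lift_inj _ ord_max).
    apply: (@perm_inj _ (lift_perm (lift ord_max q) ord_max s)).
    by rewrite lift_perm_id E lift_perm_id.
  split=> //; rewrite -(delp_lift (lift ord_max q) ord_max s) E Eq.
  by rewrite delp_lift.
move=> s q st /lr_maxP qmax; apply/negP => /(contains_lift k_gt1)[]; first exact/negP.
move=> [i0 [y [y1 y2 y3 y4]]].
have qE : lift ord_max q = q :> nat by exact: lift_max.
have tlt (j : 'I_k) : j != i0 -> t j < t i0.
  by move=> ji; rewrite -y2 //= ltn_ord.
have i0E : i0 = b.
  apply/eqP; rewrite eq_sym; apply/negPn/negP => /tlt.
  by have := ltn_ord (t i0); lia.
move: i0E y1 y2 y3 y4 tlt => -> {i0} y1 _ y3 y4 tlt.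
have anb : a != b by apply: contraTneq ab => ->; rewrite ltnn.
have yaq : y a < q by have := y1 _ anb; rewrite qE ab.
have tla (j : 'I_k) : j != b -> j != a -> t j < t a.
  move=> jb ja; have := tlt _ jb.
  suff : t j != t a :> nat by lia.
  by apply: contra ja => /eqP/ord_inj/perm_inj ->.
have slt (j : 'I_k) : j != b -> s (y j) < s q.
  move=> jb; have [->|ja] := eqVneq j a; first exact: qmax.
  by apply: ltn_trans (qmax _ yaq); rewrite y4 // tla.
have yneq (j : 'I_k) : j != b -> y j != q :> nat.
  by move=> /slt; apply: contraTneq => /ord_inj ->; rewrite ltnn.
case/negP: st; apply/containsP.
exists (fun j => if j == b then q else y j); split=> j j'.
- case: eqVneq => [->|jn]; case: eqVneq => [->|jn']; [by rewrite ltnn| | |exact: y3].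
    by have := y1 _ jn'; have := yneq _ jn'; rewrite qE; lia.
  by have := y1 _ jn; have := yneq _ jn; rewrite qE; lia.
- case: eqVneq => [->|jn]; case: eqVneq => [->|jn']; [by rewrite !ltnn| | |exact: y4].
    by have := slt _ jn'; have := tlt _ jn'; lia.
  by rewrite slt ?tlt.
Qed.

(** * Patterns of length at most five *)

Definition sum_decb (k : nat) (u : seq nat) : bool :=
  has (fun c => all (fun i => all (fun j => nth 0 u i < nth 0 u j)
    (iota c (k - c))) (iota 0 c)) (iota 1 k.-1).

Definition skew_decb (k : nat) (u : seq nat) : bool :=
  has (fun c => all (fun i => all (fun j => nth 0 u j < nth 0 u i)
    (iota c (k - c))) (iota 0 c)) (iota 1 k.-1).

Definition no_descentb (k : nat) (u : seq nat) : bool :=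
  all (fun i => nth 0 u i != (nth 0 u i.+1).+1) (iota 0 k.-1).

Definition no_ascentb (k : nat) (u : seq nat) : bool :=
  all (fun i => (nth 0 u i).+1 != nth 0 u i.+1) (iota 0 k.-1).

(** Exhaustive evaluation; patterns are lists of values here so that the four properties compute. *)
Lemma small_permutations :
  all (fun k => all (fun u =>
    [|| sum_decb k u, skew_decb k u, no_descentb k u | no_ascentb k u])
    (permutations (iota 0 k))) (iota 0 6).
Proof. by vm_compute. Qed.

Lemma small_pattern (k : nat) (t : 'S_k) : k <= 5 ->
  [\/ sum_dec t, skew_dec t, no_descent_adjacency t |
      no_descent_adjacency (revp t)].
Proof.
move=> k5; pose u := [seq nat_of_ord (t i) | i <- enum 'I_k].
have uE (i : 'I_k) : nth 0 u i = t i.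
  by rewrite (nth_map i) ?size_enum_ord // nth_ord_enum.
have u_perm : u \in permutations (iota 0 k).
  rewrite mem_permutations -val_enum_ord /u.
  rewrite (map_comp (@nat_of_ord k) t); apply: perm_map.
  apply: uniq_perm; rewrite ?enum_uniq ?(map_inj_uniq (@perm_inj _ t)) ?enum_uniq //.
  move=> x; rewrite mem_enum; apply/mapP; exists ((t^-1)%g x); rewrite ?permKV //.
  by rewrite mem_enum.
have /allP/(_ k) := small_permutations; rewrite mem_iota ltnS k5 => /(_ isT).
move=> /allP/(_ _ u_perm)/or4P[/hasP[c]|/hasP[c]|/allP H|/allP H].
- rewrite mem_iota => /andP[c0 ck] /allP H; apply: Or41; exists c; split=> //; first lia.
  move=> i j ic cj; rewrite -!uE; apply: (allP (H i _)); rewrite mem_iota //.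
  by have := ltn_ord j; lia.
- rewrite mem_iota => /andP[c0 ck] /allP H; apply: Or42; exists c; split=> //; first lia.
  move=> i j ic cj; rewrite -!uE; apply: (allP (H i _)); rewrite mem_iota //.
  by have := ltn_ord j; lia.
- apply: Or43 => i j ji tij; have := H i; rewrite mem_iota -ji !uE tij eqxx.
  by have := ltn_ord j; lia.
- apply: Or44 => i j ji; rewrite !revpE => tij; have := H (rev_ord j).
  rewrite mem_iota; have E : (rev_ord j).+1 = rev_ord i by have := ltn_ord j; move=> /=; lia.
  by rewrite E !uE tij eqxx; have := ltn_ord (rev_ord i); rewrite -E; lia.
Qed.

Lemma sum_dec_ratio_ineq (k : nat) (t : 'S_k) n : sum_dec t ->
  n.+2 * #|avoiders n.+1 t| ^ 2 <=
  #|avoiders n.+2 t| * (n.+1 * #|avoiders n t| + #|avoiders n.+1 t|).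
Proof. by move=> [c [c0 ck cP]]; apply: (sum_dec_ratio_ineq_at c0 ck cP). Qed.

(** A pattern with least first or greatest last letter is sum-decomposable. The skew-decomposable
    case and the last small case pass to the reverse, which has equally many avoiders. *)
Lemma ratio_ineq (k : nat) (t : 'S_k) n : 1 < k ->
  k <= 5 \/ starts_with_min t \/ ends_with_max t ->
  n.+2 * #|avoiders n.+1 t| ^ 2 <=
  #|avoiders n.+2 t| * (n.+1 * #|avoiders n t| + #|avoiders n.+1 t|).
Proof.
move=> k_gt1 H.
have tneq (j i : 'I_k) : j != i -> t j != t i :> nat.
  by apply: contra => /eqP/ord_inj/perm_inj ->.
have cE m : #|avoiders m (revp t)| = #|avoiders m t|.
  exact: card_avoiders_revp.
have skewP : skew_dec t -> n.+2 * #|avoiders n.+1 t| ^ 2 <=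
    #|avoiders n.+2 t| * (n.+1 * #|avoiders n t| + #|avoiders n.+1 t|).
  move=> /skew_dec_revp/(sum_dec_ratio_ineq n).
  by rewrite (cE n) (cE n.+1) (cE n.+2).
have [/sum_dec_ratio_ineq//|t_sum] := pselect (sum_dec t).
have [/skewP//|t_skew] := pselect (skew_dec t).
case: H => [/(small_pattern t)[//|//|t_adj|t_adj]|[[i [/= i0 ti]]|[i [ik ti]]]].
- exact: no_descent_ratio_ineq.
- rewrite -(cE n) -(cE n.+1) -(cE n.+2); apply: no_descent_ratio_ineq => //.
  by move=> /skew_dec_revp; rewrite revpK.
- case: t_sum; exists 1; split=> // a b a1 b1.
  have -> : a = i by apply: ord_inj; lia.
  have /tneq : b != i by apply/eqP => E; move: b1; rewrite E; lia.
  by rewrite ti; lia.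
- case: t_sum; exists k.-1; split; [lia|lia|move=> a b a1 b1].
  have -> : b = i by apply: ord_inj; have := ltn_ord b; lia.
  have /tneq : a != i by apply/eqP => E; move: a1; rewrite E; lia.
  by have := ltn_ord (t a); lia.
Qed.

(** Permutations of size at most 1 are too short to contain [t]; supermultiplicativity does the
    rest. *)
Lemma avoiders_gt0 (k : nat) (t : 'S_k) n : 1 < k -> 0 < #|avoiders n t|.
Proof.
move=> k_gt1.
have small m (s : 'S_m) : m <= 1 -> ~~ contains s t.
  move=> m1; apply/containsP => -[f [fpos _]].
  have := fpos (Ordinal (ltnW k_gt1)) (Ordinal k_gt1) isT.
  by have := ltn_ord (f (Ordinal k_gt1)); lia.
have small_gt0 m : m <= 1 -> 0 < #|avoiders m t|.
  by move=> m1; apply/card_gt0P; exists 1%g; rewrite mem_avoiders small.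
elim: n => [|n IH]; first exact: small_gt0.
rewrite -[n.+1]addn1; apply: leq_trans (avoiders_supermul n 1 t).
by rewrite muln_gt0 IH small_gt0.
Qed.

(** * Limits *)

Import Order.TTheory GRing.Theory Num.Theory.
Import numFieldNormedType.Exports.

(** * Growth and ratios of real sequences *)

Section Sequences.
Local Open Scope ring_scope.
Variable R : realType.

Lemma expr_unbounded (b K : R) : 1 < b -> exists Q : nat, K < b ^+ Q.
Proof.
move=> b1.
have bern (n : nat) : 1 + n%:R * (b - 1) <= b ^+ n.
  elim: n => [|n IH]; first by rewrite mul0r addr0 expr0.
  rewrite exprS -natr1; have n0 : 0 <= n%:R :> R by [].
  have : 0 <= n%:R * (b - 1) ^+ 2 by rewrite mulr_ge0 // sqr_ge0.
  by move: IH; set x := b ^+ n; nra.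
have b0 : 0 < b - 1 by rewrite subr_gt0.
exists (Num.truncn (K / (b - 1))).+1; apply: lt_le_trans (bern _).
have := truncnS_gt (K / (b - 1)); rewrite ltr_pdivrMr // => KQ.
by apply: lt_trans KQ _; rewrite ltrDr.
Qed.

Lemma root_exists (x : R) (n : nat) : (0 < n)%N -> 0 < x ->
  exists2 y, 0 < y & y ^+ n = x.
Proof.
move=> n0 x0; exists (x `^ n%:R^-1); first exact: powR_gt0.
rewrite -powR_mulrn ?powR_ge0 // -powRrM mulVf ?powRr1 ?ltW //.
by rewrite pnatr_eq0 -lt0n.
Qed.

Variable a : nat -> R.
Hypothesis a_ge1 : forall n, 1 <= a n.

Let a_gt0 n : 0 < a n. Proof. exact: lt_le_trans ltr01 _. Qed.

(** For [n = q m + r], [a n] is at least [a_m^q = b^q M^(q m)] with [b > 1], and for large [q] the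
    factor [b^q] exceeds [M^r]. *)
Lemma supermul_lower (M : R) (m : nat) :
  (forall i j, a i * a j <= a (i + j)%N) ->
  (0 < m)%N -> 0 < M -> M ^+ m < a m ->
  exists N, forall n, (N <= n)%N -> M ^+ n < a n.
Proof.
move=> a_mul m_gt0 M0 Mm.
have a_pow q : a m ^+ q <= a (q * m)%N.
  elim: q => [|q IH]; first by rewrite expr0.
  rewrite exprS mulSn; apply: le_trans (a_mul _ _).
  by rewrite ler_pM2l.
pose b := a m / M ^+ m.
have b1 : 1 < b by rewrite ltr_pdivlMr ?exprn_gt0 // mul1r.
(* Bounds [M ^+ r] for every [r < m], also when [M < 1]. *)
pose K := Num.max 1 M ^+ m.
have M1 : 1 <= Num.max 1 M by rewrite le_max lexx.
have [Q KQ] := expr_unbounded K b1.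
exists (Q * m)%N => n Qn.
rewrite (divn_eq n m); set q := (n %/ m)%N; set r := (n %% m)%N.
have r_lt : (r < m)%N by rewrite ltn_mod.
have Qq : (Q <= q)%N by rewrite leq_divRL.
apply: lt_le_trans (a_mul _ _).
apply: (@lt_le_trans _ _ (a m ^+ q)); last first.
  apply: le_trans (a_pow q) _; rewrite ler_peMr // ltW //.
have -> : a m ^+ q = b ^+ q * M ^+ (q * m).
  by rewrite mulnC exprM -exprMn divfK // gt_eqF // exprn_gt0.
rewrite addnC exprD ltr_pM2r ?exprn_gt0 //.
apply: (@le_lt_trans _ _ K).
  apply: (@le_trans _ _ (Num.max 1 M ^+ r)).
    by apply: lerXn2r; rewrite ?nnegrE ?le_max ?lexx ?ler01 ?orbT // ltW.
  by rewrite ler_weXn2l // ltnW.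
apply: lt_le_trans KQ _; rewrite ler_weXn2l // ltW //.
Qed.

Variable L : R.
Hypothesis a_le : forall n, a n <= L ^+ n.

Let L_ge1 : 1 <= L. Proof. by apply: le_trans (a_ge1 1) _; rewrite (le_trans (a_le 1)). Qed.

Let L_gt0 : 0 < L. Proof. exact: lt_le_trans L_ge1. Qed.

Lemma growth_step (M : R) (m J : nat) : 0 <= M ->
  (forall i, (i < J)%N -> M * a (m + i) <= a (m + i).+1) ->
  M ^+ J * a m <= a (m + J).
Proof.
move=> M0; elim: J => [|J IH] H; first by rewrite expr0 mul1r addn0.
rewrite exprS -mulrA addnS; apply: le_trans (H J _) => //.
by rewrite ler_wpM2l // IH // => i iJ; apply: H; exact: ltnW.
Qed.

(** Otherwise [a (N + Q)] is at least [M^Q], which beats [L^(N + Q)] once [(M / L)^Q > L^N]. *)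
Lemma ratio_not_eventually_large (M : R) (N : nat) : L < M ->
  ~ (forall n, (N <= n)%N -> M * a n <= a n.+1).
Proof.
move=> LM H; have M0 : 0 < M by exact: lt_trans LM.
have ML : 1 < M / L by rewrite ltr_pdivlMr // mul1r.
have [Q] := expr_unbounded (L ^+ N) ML.
rewrite expr_div_n ltr_pdivlMr ?exprn_gt0 // -exprD => LQ.
have := @growth_step M N Q (ltW M0) (fun i _ => H _ (leq_addr _ _)).
apply/negP; rewrite -ltNge; apply: le_lt_trans (a_le _) _.
by apply: lt_le_trans LQ _; rewrite ler_peMr ?exprn_ge0 // ltW.
Qed.

Hypothesis a_lower : forall M, 0 < M -> M < L ->
  exists N, forall n, (N <= n)%N -> M ^+ n < a n.
Hypothesis a_ratio : forall n,
  n.+2%:R * a n.+1 ^+ 2 <= a n.+2 * (n.+1%:R * a n + a n.+1).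

(** If [a_(m+1) > M a_m], the ratios stay above [M'] for [J] steps, about [m / q] of them. Then
    [a (m + J)] exceeds [M'^J (lam L)^m >= L^(m + J)], against the upper bound. *)
Lemma ratio_eventually_le (M : R) : L < M ->
  exists N, forall n, (N <= n)%N -> a n.+1 <= M * a n.
Proof.
move=> LM; have M0 : 0 < M by exact: lt_trans LM.
pose M' := (L + M) / 2.
have LM' : L < M' by rewrite /M'; lra.
have M'M : M' < M by rewrite /M'; lra.
have M'0 : 0 < M' by exact: lt_trans LM'.
(* The inverse ratio needs about [d m] steps to rise from [1/M] to [1/M']; [q] makes [m / q] steps
   fit. *)
pose d := M'^-1 - M^-1.
have d0 : 0 < d by rewrite subr_gt0 ltf_pV2.
pose q := (Num.truncn d^-1).+1.
have q0 : 0 < q%:R :> R by [].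
have qd : q%:R^-1 <= d.
  by rewrite -[d]invrK lef_pV2 ?posrE ?invr_gt0 // ltW // truncnS_gt.
(* By [a_ratio] this rescaled inverse ratio grows by at most 1 per step. *)
pose x j := j.+1%:R * a j / a j.+1.
have x_step j : x j.+1 <= x j + 1.
  rewrite /x ler_pdivrMr //.
  have -> : (j.+1%:R * a j / a j.+1 + 1) * a j.+2 =
      a j.+2 * (j.+1%:R * a j + a j.+1) / a j.+1.
    by field; rewrite gt_eqF.
  by rewrite ler_pdivlMr // -mulrA -expr2.
have x_steps m i : x (m + i)%N <= x m + i%:R.
  elim: i => [|i IH]; first by rewrite addn0 addr0.
  by rewrite addnS -natr1 addrA; apply: le_trans (x_step _) _; rewrite lerD2r.
have kap0 : 0 < L / M' by rewrite divr_gt0.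
(* With this root the loss [lam^m] in the lower bound for [a m] is made up by the gain [(M' / L)^J],
   because [2 q J >= m]. *)
have [lam lam0 lamE] := @root_exists (L / M') (2 * q) isT kap0.
have lam1 : lam < 1.
  rewrite ltNge; apply/negP => /(exprn_ege1 (2 * q)).
  by rewrite lamE leNgt ltr_pdivrMr // mul1r LM'.
have [N HN] : exists N, forall n, (N <= n)%N -> (lam * L) ^+ n < a n.
  by apply: a_lower; rewrite ?mulr_gt0 // gtr_pMl.
(* Beyond [N] the lower bound holds, and [m >= q] gives [J > 0]. *)
exists (maxn N q) => m; rewrite geq_max => /andP[Nm qm].
rewrite leNgt; apply/negP => big.
have xm : x m < m.+1%:R / M.
  rewrite /x ltr_pdivrMr // mulrAC ltr_pdivlMr // -mulrA ltr_pM2l //.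
  by rewrite mulrC.
pose J := (m.+1 %/ q)%N.
have J0 : (0 < J)%N by rewrite divn_gt0 // ltnW.
have Jm : (J * q <= m.+1)%N by exact: leq_trunc_div.
have step : M' ^+ J * a m <= a (m + J).
  apply: growth_step => [|i iJ]; first exact: ltW.
  have xi : x (m + i)%N < (m + i).+1%:R / M'.
    apply: le_lt_trans (x_steps m i) _.
    have iq : i%:R <= m.+1%:R * q%:R^-1 :> R.
      rewrite ler_pdivlMr // -natrM ler_nat.
      by apply: leq_trans Jm; rewrite leq_mul2r ltnW ?orbT.
    have iqd : i%:R <= m.+1%:R * d by apply: le_trans iq _; rewrite ler_wpM2l.
    apply: (@lt_le_trans _ _ (m.+1%:R / M')).
      apply: lt_le_trans (ltr_leD xm iqd) _.
      by rewrite -mulrDr /d addrC subrK.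
    by rewrite ler_wpM2r ?invr_ge0 ?(ltW M'0) // ler_nat ltnS leq_addr.
  move: xi; rewrite /x ltr_pdivrMr // mulrAC ltr_pdivlMr // -mulrA ltr_pM2l //.
  by rewrite mulrC => /ltW.
have := le_trans step (a_le _).
apply/negP; rewrite -ltNge.
apply: (@le_lt_trans _ _ (M' ^+ J * (lam * L) ^+ m)); last first.
  by rewrite ltr_pM2l ?exprn_gt0 // HN.
have LJ : L ^+ J <= M' ^+ J * lam ^+ m.
  rewrite -ler_pdivrMl ?exprn_gt0 // mulrC -expr_div_n -lamE -exprM.
  apply: ler_wiXn2l; [exact: ltW|exact: ltW|].
  have : (m.+1 < J.+1 * q)%N by exact: ltn_ceil.
  move=> /ltnW/ltnW/leq_trans; apply; rewrite -mulnA [(q * J)%N]mulnC mulnA.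
  by rewrite leq_mul2r mul2n -addnn -addn1 leq_add2l J0 orbT.
by rewrite addnC exprD [(lam * L) ^+ m]exprMn mulrA ler_pM2r ?exprn_gt0.
Qed.
End Sequences.

(** * Limits of roots, upper and lower limits *)

Section Limits.
Local Open Scope ring_scope.
Local Open Scope classical_set_scope.
Variable R : realType.

(** Fekete's lemma: the limit is the supremum of the roots over [n > 0], or [+oo] when these are
    unbounded. *)
Lemma supermul_root_lim (a : nat -> R) :
  (forall n, 1 <= a n) -> (forall i j, a i * a j <= a (i + j)%N) ->
  let l := limn (fun n : nat => ((a n `^ n%:R^-1)%R)%:E) in
  l = +oo%E \/
  exists L : R, [/\ l = L%:E, forall n, a n <= L ^+ n &
    forall M, 0 < M -> M < L -> exists N, forall n, (N <= n)%N -> M ^+ n < a n].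
Proof.
move=> a_ge1 a_mul; pose u n := a n `^ n%:R^-1.
have a_gt0 n : 0 < a n by exact: lt_le_trans ltr01 _.
have u_ge0 n : 0 <= u n by exact: powR_ge0.
have uX n : (0 < n)%N -> u n ^+ n = a n.
  move=> n0; rewrite -powR_mulrn // -powRrM mulVf ?powRr1 ?ltW //.
  by rewrite pnatr_eq0 -lt0n.
have u_lt (M : R) n : (0 < n)%N -> 0 < M -> (M < u n) = (M ^+ n < a n).
  by move=> n0 M0; rewrite -{1}uX // ltr_pXn2r // nnegrE // ltW.
have lower (M : R) m : (0 < m)%N -> 0 < M -> M < u m ->
    exists N, forall n, (N <= n)%N -> M ^+ n < a n.
  by move=> m0 M0; rewrite u_lt // => /(supermul_lower a_ge1 a_mul m0 M0).
have lower_u (M : R) m : (0 < m)%N -> 0 < M -> M < u m -> \forall n \near \oo, M < u n.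
  move=> m0 M0 /(lower _ _ m0 M0)[N HN]; exists (maxn N 1) => // n /=.
  by rewrite geq_max => /andP[Nn n0]; rewrite u_lt // HN.
pose S := [set u n | n in [set n | (0 < n)%N]].
have S1 : S !=set0 by exists (u 1%N), 1%N.
have [ubS|nubS] := pselect (has_ubound S).
- right; exists (sup S).
  have uS n : (0 < n)%N -> u n <= sup S.
    by move=> n0; apply: ub_le_sup => //; exists n.
  have S_gt (M : R) : 0 < M -> M < sup S -> exists2 m, (0 < m)%N & M < u m.
    move=> M0 MS; apply: contrapT => H; move: MS; apply/negP; rewrite -leNgt.
    apply: sup_le_ub => // _ [m m0 <-]; rewrite leNgt; apply/negP => Mm.
    by apply: H; exists m.
  have S0 : 0 < sup S.
    by apply: lt_le_trans (uS 1%N isT); rewrite /u powR_gt0.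
  split.
  + apply/cvg_lim => //; apply: cvg_EFin; first exact: nearW.
    apply/cvgrPdist_le => eps eps0.
    (* The maximum keeps [M] positive when [eps] is large. *)
    pose M := Num.max (sup S - eps) (sup S / 2).
    have M0 : 0 < M by rewrite lt_max divr_gt0 ?orbT.
    have MS : M < sup S by rewrite gt_max; apply/andP; split; lra.
    have [m m0 Mm] := S_gt _ M0 MS.
    have near1 : \forall n \near \oo, (0 < n)%N by exact: nbhs_infty_gt.
    apply: filterS2 near1 (lower_u _ _ m0 M0 Mm) => n n0 Mn /=.
    rewrite ger0_norm ?subr_ge0 ?uS // lerBlDr -lerBlDl.
    by apply: le_trans (ltW Mn); rewrite le_max lexx.
  (* The index 0 lies outside [S]; supermultiplicativity at 0 gives [a 0 <= 1]. *)
  + case=> [|n]; first by rewrite expr0 -(ler_pM2l (a_gt0 0%N)) mulr1 a_mul.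
    by rewrite -uX // lerXn2r // ?nnegrE ?(ltW S0) // uS.
  + by move=> M M0 /(S_gt _ M0)[m m0]; exact: lower.
- left; apply/cvg_lim => //; apply/cvgeyPge => A.
  have [m m0 Am] : exists2 m, (0 < m)%N & Num.max 1 A < u m.
    apply: contrapT => H; apply: nubS; exists (Num.max 1 A) => _ [m m0 <-].
    by rewrite leNgt; apply/negP => um; apply: H; exists m.
  have A0 : 0 < Num.max 1 A by rewrite lt_max ltr01.
  apply: filterS (lower_u _ _ m0 A0 Am) => n un.
  by rewrite lee_fin; apply: le_trans (ltW un); rewrite le_max lexx orbT.
Qed.

Lemma limn_esup_le_near (u : nat -> R) (M : R) N :
  (forall n, (N <= n)%N -> u n <= M) ->
  (limn_esup (fun n => (u n)%:E) <= M%:E)%E.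
Proof.
move=> H; rewrite /limn_esup limf_esupE.
apply: (@le_trans _ _ (ereal_sup [set (u n)%:E | n in [set n | (N <= n)%N]])).
  by apply: ereal_inf_lbound; exists [set n | (N <= n)%N] => //; exact: nbhs_infty_ge.
by apply: ge_ereal_sup => _ [n /= Nn <-]; rewrite lee_fin H.
Qed.

(** Choose [M] strictly between; the lower limit is the limit of the infima of tails, so one of
    these is at least [M]. *)
Lemma limn_einf_gt_near (u : nat -> R) (L : R) :
  (L%:E < limn_einf (fun n => (u n)%:E))%E ->
  exists M N, L < M /\ forall n, (N <= n)%N -> M <= u n.
Proof.
move=> H.
have [M LM Ml] : exists2 M, L < M & (M%:E < limn_einf (fun n => (u n)%:E))%E.
  case: (limn_einf _) H => [r| |] //.
    rewrite lte_fin => Lr; exists ((L + r) / 2); rewrite ?lte_fin; lra.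
  by exists (L + 1); rewrite ?ltry //; lra.
move: Ml; rewrite limn_einf_lim => /lte_lim.
move=> /(_ (nondecreasing_einfs _) (@is_cvg_einfs _ _))[N _ HN].
exists M, N; split=> // n Nn; rewrite -lee_fin.
apply: le_trans (HN N (leqnn _)) _; apply: ereal_inf_lbound; by exists n.
Qed.

End Limits.

(** * Bounds for the expected number of left-to-right maxima *)

Theorem theorem2p9 (R : realType) (k : nat) (t : 'S_k)
    (ht : starts_with_ascent t \/ max_right_of_submax t) :
  (limn_einf (fun n : nat =>
     (expect_avoiders t (fun s : 'S_n => ((LR s)%:R : R)%R))%:E)
   <= growth_rate R t)%E
  /\
  (k <= 5 \/ starts_with_min t \/ ends_with_max t ->
   (limn_esup (fun n : nat =>
      (expect_avoiders t (fun s : 'S_n => ((LR s)%:R : R)%R))%:E)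
    <= growth_rate R t)%E).
Proof.
have k_gt1 : 1 < k.
  case: ht => [[i [j [_ /= j1 _]]]|[i [j [ti _ _]]]]; last by rewrite -ti.
  by have := ltn_ord j; rewrite j1.
pose a n : R := (#|avoiders n t|%:R)%R.
have a_ge1 n : (1 <= a n)%R by rewrite ler1n avoiders_gt0.
have a_gt0 n : (0 < a n)%R by exact: lt_le_trans ltr01 _.
have a_mul i j : (a i * a j <= a (i + j)%N)%R.
  by rewrite -natrM ler_nat avoiders_supermul.
pose e n := expect_avoiders t (fun s : 'S_n => ((LR s)%:R : R)%R).
(* The expectation times [a n] is the total number of left-to-right maxima, which the insertions
   bound by [a n.+1]. *)
have e_le n : (e n * a n <= a n.+1)%R.
  rewrite /e /expect_avoiders divfK ?gt_eqF ?a_gt0 //= -natr_sum ler_nat.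
  by case: ht => H; [exact: sum_LR_ascent|exact: sum_LR_max_right].
rewrite /growth_rate.
(* An infinite growth rate bounds everything; otherwise it is a real [L]. *)
have [->|[L [-> a_le a_lower]]] := supermul_root_lim a_ge1 a_mul.
  by split=> [|_]; rewrite leey.
split=> [|H].
  rewrite leNgt; apply/negP => /limn_einf_gt_near[M [N [LM HM]]].
  apply: (ratio_not_eventually_large a_ge1 a_le LM (N := N)) => n /HM eM.
  by apply: le_trans (e_le n); rewrite ler_pM2r.
apply/lee_addgt0Pr => eps eps0; rewrite -EFinD.
have LM : (L < L + eps)%R by rewrite ltrDl.
have a_ratio n :
    (n.+2%:R * a n.+1 ^+ 2 <= a n.+2 * (n.+1%:R * a n + a n.+1))%R.
  by rewrite -natrX -!natrM -natrD -natrM ler_nat ratio_ineq.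
have [N HN] := ratio_eventually_le a_ge1 a_le a_lower a_ratio LM.
apply: (@limn_esup_le_near _ _ _ N) => n /HN an.
by rewrite -(ler_pM2r (a_gt0 n)); exact: le_trans (e_le n) an.
Qed.
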